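(* If $(Q,\sigma)$ is a totally proper cyclically ordered quiver on $n$ vertices whose quiver $Q$ is mutation-acyclic, then its Markov invariant satisfies $M_Q\ge 0$. If, additionally, $Q$ is connected, then $M_Q\ge n-1$.
   Context: A quiver is a finite directed graph with parallel edges (arrows) allowed and no oriented cycles of length 1 or 2; all vertices are mutable. Write $u\to v$ if there is at least one arrow from $u$ to $v$; $\mathrm{In}(v)=\{u: u\to v\}$, $\mathrm{Out}(v)=\{u: v\to u\}$. Exchange matrix: $B_Q=(b_{uv})$, $b_{uv}=\#\{\text{arrows }u\to v\}-\#\{\text{arrows }v\to u\}$. Mutation $\mu_v(Q)$: (1) for each oriented path $u\to v\to w$ add a new arrow $u\to w$ (with multiplicity); (2) reverse all arrows incident to $v$; (3) remove oriented 2-cycles one at a time until none remain. Quivers are mutation equivalent if related by a sequence of mutations; mutation-acyclic means mutation equivalent to an acyclic quiver (one without directed cycles). Connected means the underlying undirected graph is connected. A cyclic ordering $\sigma$ is a linear ordering up to cyclic shifts; the linear orderings in this class are associated to $\sigma$. Moving clockwise means moving in the increasing direction (wrapping around). A cyclically ordered quiver (COQ) $(Q,\sigma)$ is a quiver with a cyclic ordering of its vertices. An oriented path $u\to v\to w$ makes a right turn at $v$ if $u<v<w$ in some linear order associated to $\sigma$; $v$ is proper if every oriented path $u\to v\to w$ makes a right turn at $v$. A wiggle fixes $Q$ and transposes two vertices adjacent in the cyclic ordering and not joined by an arrow of $Q$; wiggle equivalence is the generated equivalence relation. A COQ is proper if for every vertex $v$ there is a wiggle equivalent COQ in which $v$ is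 proper. To mutate a COQ at a proper vertex $v$, replace $Q$ by $\mu_v(Q)$ and move $v$ clockwise, from its original position, past all elements of $\mathrm{In}(v)$ (each once) without passing any element of $\mathrm{Out}(v)$, with In and Out computed in the mutated quiver (well defined up to wiggle equivalence). The proper mutation class of a COQ is the set of COQs obtainable by sequences of such proper mutations and wiggles. A COQ is totally proper if every COQ in its proper mutation class is proper. A unipotent companion of $(Q,\sigma)$ is, for a linear order $<$ associated to $\sigma$, the unipotent upper triangular matrix $U$ with $U^T-U=B_Q$, rows and columns written in the order $<$. The Alexander polynomial is $\Delta_Q(t)=\det(tU-U^T)$ (independent of the choice of $<$), and the Markov invariant is $M_Q=n+(\text{coefficient of }t^{n-1}\text{ in }\Delta_Q(t))$. *)

(* Defs.v *)
From HB Require Import structures.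
From Stdlib Require Import Relation_Operators.
From mathcomp Require Import all_boot all_order all_algebra.

Set Implicit Arguments.
Unset Strict Implicit.
Unset Printing Implicit Defensive.

Import Order.TTheory GRing.Theory Num.Theory.

(* [arrows (u, v)] is the number of arrows from [u] to [v]. *)
Record quiver (V : finType) := Quiver {
  arrows : {ffun V * V -> nat};
  no_loop : [forall u, arrows (u, u) == 0];
  no_2cycle : [forall u, forall v, (arrows (u, v) == 0) || (arrows (v, u) == 0)]
}.

Section Quivers.
Variable V : finType.
Implicit Types (Q : quiver V) (u v w : V).

Definition arrow Q : rel V := fun u v => 0 < arrows Q (u, v).

Definition In Q v : {set V} := [set u | arrow Q u v].
Definition Out Q v : {set V} := [set u | arrow Q v u].

Definition add_paths v (a : {ffun V * V -> nat}) : {ffun V * V -> nat} :=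
  [ffun p => a p + a (p.1, v) * a (v, p.2)].

Definition reverse_at v (a : {ffun V * V -> nat}) : {ffun V * V -> nat} :=
  [ffun p => if (p.1 == v) || (p.2 == v) then a (p.2, p.1) else a p].

(* Removing the 2-cycles between u and w one at a time leaves the truncated
   difference of the two multiplicities in each direction. *)
Definition cancel_2cycles (a : {ffun V * V -> nat}) : {ffun V * V -> nat} :=
  [ffun p => a p - a (p.2, p.1)].

Definition mutate_arrows Q v : {ffun V * V -> nat} :=
  cancel_2cycles (reverse_at v (add_paths v (arrows Q))).

Fact mutate_no_loop Q v : [forall u, mutate_arrows Q v (u, u) == 0].
Proof. by apply/forallP => u; rewrite ffunE subnn. Qed.

Fact mutate_no_2cycle Q v : [forall u, forall w,
  (mutate_arrows Q v (u, w) == 0) || (mutate_arrows Q v (w, u) == 0)].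
Proof.
apply/forallP => u; apply/forallP => w.
by rewrite ![mutate_arrows _ _ _]ffunE /= !subn_eq0 leq_total.
Qed.

Definition mutate Q v : quiver V :=
  Quiver (mutate_no_loop Q v) (mutate_no_2cycle Q v).

Definition mutation_equivalent Q Q' : Prop :=
  exists vs : seq V, Q' = foldl mutate Q vs.

Definition acyclic Q : Prop := forall p : seq V, cycle (arrow Q) p -> p = [::].

Definition mutation_acyclic Q : Prop :=
  exists2 Q', mutation_equivalent Q Q' & acyclic Q'.

Definition connected Q : Prop :=
  forall u v, connect (fun x y => arrow Q x y || arrow Q y x) u v.

Definition exchange Q u v : int :=
  ((arrows Q (u, v))%:Z - (arrows Q (v, u))%:Z)%R.

End Quivers.

(* The cyclic ordering is given by one of its associated linear orderings, the
   increasing enumeration [ordering] of all vertices; [same_COQ] below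
   identifies the choices, and wiggle equivalence is closed under it. *)
Record COQ (V : finType) := MkCOQ {
  COQ_quiver :> quiver V;
  ordering : #|V|.-tuple V;
  ordering_uniq : uniq ordering
}.

Section CyclicallyOrderedQuivers.
Variable V : finType.
Implicit Types (C : COQ V) (s : seq V) (u v w : V).

(* [associated s s'] : s and s' are linear orderings of one cyclic ordering. *)
Definition associated s s' : Prop := exists k, s' = rot k s.

Definition same_COQ C C' : Prop :=
  COQ_quiver C' = COQ_quiver C /\ associated (ordering C) (ordering C').

Definition right_turn C u v w : Prop :=
  exists2 s, associated (ordering C) s & index u s < index v s < index w s.

Definition proper_vertex C v : Prop :=
  forall u w, arrow C u v -> arrow C v w -> right_turn C u v w.

Definition wiggle C C' : Prop :=
  COQ_quiver C' = COQ_quiver C /\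
  exists u v s, [/\ associated (ordering C) [:: u, v & s],
                    associated (ordering C') [:: v, u & s]
                  & ~~ arrow C u v && ~~ arrow C v u].

Definition wiggle_equivalent : COQ V -> COQ V -> Prop :=
  clos_refl_sym_trans (COQ V) (fun C C' => same_COQ C C' \/ wiggle C C').

Definition proper C : Prop :=
  forall v, exists2 C', wiggle_equivalent C C' & proper_vertex C' v.

(* Moving v clockwise from its position past exactly the vertices of [s1]; the
   remaining freedom in choosing [s1] amounts to wiggles. *)
Definition proper_mutation v C C' : Prop :=
  [/\ proper_vertex C v,
      COQ_quiver C' = mutate C v
    & exists s1 s2, [/\ associated (ordering C) (v :: s1 ++ s2),
                        associated (ordering C') (s1 ++ v :: s2),
                        {subset In C' v <= s1}
                      & {subset Out C' v <= s2}]].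

Definition proper_mutation_class : COQ V -> COQ V -> Prop :=
  clos_refl_trans (COQ V) (fun C C' =>
    wiggle_equivalent C C' \/ exists v, proper_mutation v C C').

Definition totally_proper C : Prop :=
  forall C', proper_mutation_class C C' -> proper C'.

Local Open Scope ring_scope.

Definition exchange_mx C : 'M[int]_#|V| :=
  \matrix_(i, j) exchange C (tnth (ordering C) i) (tnth (ordering C) j).

Definition unipotent_upper n (U : 'M[int]_n) : Prop :=
  forall i j : 'I_n, (j <= i)%N -> U i j = (i == j)%:R.

Definition unipotent_companion C : 'M[int]_#|V| :=
  \matrix_(i, j) if (i < j)%N then - exchange_mx C i j else (i == j)%:R.

Lemma exchangeC (Q : quiver V) u v : exchange Q u v = - exchange Q v u.
Proof. by rewrite /exchange opprB. Qed.

Lemma unipotent_companionP C (U : 'M[int]_#|V|) :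
  unipotent_upper U /\ U^T - U = exchange_mx C <-> U = unipotent_companion C.
Proof.
split=> [[Uup UB]|->].
  apply/matrixP => i j; rewrite [RHS]mxE; case: ltnP => [lt_ij|/Uup //].
  rewrite -UB !mxE (Uup j i (ltnW lt_ij)) opprB.
  by rewrite -val_eqE /= gtn_eqF // subr0.
split=> [i j le_ji|]; first by rewrite mxE ltnNge le_ji.
apply/matrixP => i j; rewrite !mxE; case: (ltngtP i j) => [lt_ij|lt_ji|/val_inj->].
- by rewrite -val_eqE /= gtn_eqF // sub0r opprK.
- by rewrite -val_eqE /= gtn_eqF // subr0 -exchangeC.
by rewrite subrr /exchange subrr.
Qed.

Definition alexander C : {poly int} :=
  let U := map_mx polyC (unipotent_companion C) in \det ('X *: U - U^T).

(* On the empty vertex set this reads the coefficient of t^0; that case is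
   irrelevant. *)
Definition markov C : int := #|V|%:Z + (alexander C)`_(#|V|.-1).

End CyclicallyOrderedQuivers.

(* Main.v *)
Require Import Defs.
From Stdlib Require Import Relation_Operators.
From mathcomp Require Import all_boot all_order perm all_algebra.
From mathcomp Require Import zify ring.

(** Write [x < y] for the order of a linear ordering associated to the cyclic
one, and U for the unipotent companion.  The argument has three steps.

The Alexander polynomial det(tU - U^T) has entries [- b_xy t^[x < y]] off the
diagonal.  If two linear orderings satisfy [x <' y] = [x < y] + h x - h y along
every arrow, for some integer function h on the vertices, then conjugating by
the diagonal matrix of the t^(h x) turns one matrix into the other.  Such
orderings are called cohomologous.  Rotations and wiggles preserve the
cohomology class, and so a COQ has a well-defined class and its polynomial
depends on this class alone ([vertex_alexander_cohomologous]).  A proper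
mutation replaces U by P U P^T with P an involution
([vertex_alexander_mutate]).  Hence the Markov invariant is constant along
proper mutations, and a totally proper COQ can be mutated at every vertex
([totally_proper_mutate]): it may be assumed that Q is acyclic.

For Q acyclic and the COQ totally proper, the ordering is cohomologous to one
in which all arrows go forward.  Count how often a closed walk, run along edges
in either direction, crosses the base point of the cyclic ordering; this
winding number is zero on all closed walks exactly when the required function h
exists ([potential]).  A shortest closed walk with nonzero winding number is a
chordless cycle that is not an oriented cycle.  If it contains a path
[x -> u -> y], properness says that this path makes less than one turn, and
mutating at u replaces it by an arrow [x -> y] with the same winding.  What
remains is a shorter chordless cycle, still not oriented, in a totally proper
COQ ([shorten_at_turn]).  If it contains no such path, it alternates between
sources and sinks, and mutating at a source creates one ([mutate_at_source]).
After finitely many steps the cycle has length two, where the winding number is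
zero ([winding_eq0]).

If all arrows go forward, then U = 1 - N, where N is strictly upper triangular
with the nonnegative arrow multiplicities as entries, and U^-1 is the sum of
the powers of N.  The coefficient of t^(n-1) is then - tr(U^-1 U^T), so that
the Markov invariant is the sum of the products U^-1_ij N_ij, which is at least
the sum of the N_ij^2 and hence at least the number of adjacent pairs of
vertices ([unipotent_coefficient_bound]).  Mutation preserves connectedness,
and a connected graph on n vertices has at least n - 1 edges. *)

Set Implicit Arguments.
Unset Strict Implicit.
Unset Printing Implicit Defensive.

Import Order.TTheory GRing.Theory Num.Theory.
Local Open Scope ring_scope.

(** * Linear orderings up to coboundaries *)

Section Orders.
Variable V : finType.
Implicit Types (Q : quiver V) (C : COQ V) (s : seq V) (u v w x y z : V).

Definition before s x y : bool := (index x s < index y s)%N.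

Definition enumeration s : Prop := uniq s /\ forall x, x \in s.

Lemma beforeN s x y : enumeration s -> x != y -> before s y x = ~~ before s x y.
Proof.
move=> [us sT] /eqP xy; rewrite /before.
by case: ltngtP => // e; case: xy; apply: (index_inj x (s := s)); rewrite ?inE.
Qed.

Lemma before_cat s1 s2 x y : uniq (s1 ++ s2) ->
  x \in s1 ++ s2 -> y \in s1 ++ s2 ->
  before (s1 ++ s2) x y =
    if x \in s1 then (if y \in s1 then before s1 x y else true)
    else if y \in s1 then false else before s2 x y.
Proof.
rewrite /before !index_cat !mem_cat => us.
case: ifP => [x1|] /=; case: ifP => [y1|] //= _ _ _.
- by apply: leq_trans (leq_addr _ _); rewrite index_mem.
- by apply/negbTE; rewrite -leqNgt ltnW // (leq_trans _ (leq_addr _ _)) // index_mem.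
- by rewrite ltn_add2l.
Qed.

Lemma before_remove s1 s2 v x y : uniq (s2 ++ v :: s1) ->
  x \in s2 ++ v :: s1 -> y \in s2 ++ v :: s1 -> x != v -> y != v ->
  before (s2 ++ v :: s1) x y = before (s2 ++ s1) x y.
Proof.
move=> us xs ys xv yv.
have u' : uniq (s2 ++ s1) by apply: subseq_uniq us; rewrite cat_subseq // subseq_cons.
have mem z : z \in s2 ++ v :: s1 -> z != v -> z \in s2 ++ s1.
  by rewrite !mem_cat inE => + /negbTE zv; rewrite zv.
rewrite !before_cat ?mem //.
by rewrite {2}/before /= ![v == _]eq_sym (negbTE xv) (negbTE yv).
Qed.

Lemma before_catC s1 s2 x y : uniq (s1 ++ s2) ->
  x \in s1 ++ s2 -> y \in s1 ++ s2 ->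
  ((before (s2 ++ s1) x y)%:R : int) =
    (before (s1 ++ s2) x y)%:R + (x \in s2)%:R - (y \in s2)%:R.
Proof.
move=> us xs ys; rewrite !before_cat // ?(uniq_catC s2) ?mem_cat 1?orbC -?mem_cat //.
have dis z : z \in s1 -> z \in s2 = false.
  move=> z1; move: us; rewrite cat_uniq => /and3P[_ /hasPn h _].
  by apply/negbTE/negP => /h /=; rewrite z1.
move: xs ys; rewrite !mem_cat.
case x1: (x \in s1); case y1: (y \in s1);
  rewrite ?(dis _ x1) ?(dis _ y1) /= => xs ys; rewrite ?xs ?ys //=;
  by rewrite ?addr0 ?subr0 ?subrr ?addrK ?add0r ?subrr.
Qed.

Lemma enumeration_catC s1 s2 : enumeration (s1 ++ s2) -> enumeration (s2 ++ s1).
Proof.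
by move=> [us sT]; split=> [|x]; rewrite ?(uniq_catC s2) // mem_cat orbC -mem_cat.
Qed.

Lemma enumeration_rot k s : enumeration s -> enumeration (rot k s).
Proof. by move=> [us sT]; split=> [|x]; rewrite ?rot_uniq ?mem_rot. Qed.

Lemma ordering_enumeration C : enumeration (ordering C).
Proof.
case: C => Q t ut /=; split=> // x.
have [|| _ ->] := uniq_min_size ut (s2 := enum V); rewrite ?mem_enum //.
  by move=> z _; rewrite mem_enum.
by rewrite -cardE size_tuple.
Qed.

(** The boolean [before s x y] is a 1-cochain on the arrows; the condition says
that the cochains of [s] and [s'] differ by the coboundary of [h]. *)
Definition cohomologous Q s s' : Prop := exists h : V -> int, forall x y,
  arrow Q x y -> (before s' x y)%:R = (before s x y)%:R + h x - h y.

Lemma cohomologous_refl Q s : cohomologous Q s s.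
Proof. by exists (fun=> 0) => x y _; rewrite addr0 subr0. Qed.

Lemma cohomologous_sym Q s s' : cohomologous Q s s' -> cohomologous Q s' s.
Proof.
by case=> h hP; exists (fun x => - h x) => x y /hP ->; ring.
Qed.

Lemma cohomologous_trans Q s1 s2 s3 :
  cohomologous Q s1 s2 -> cohomologous Q s2 s3 -> cohomologous Q s1 s3.
Proof.
case=> h hP [k kP]; exists (fun x => h x + k x) => x y a.
by rewrite kP // hP //; ring.
Qed.

(** Moving [s2] from the end to the front changes the order of a pair exactly when
one of its members lies in [s2], so the indicator of [s2] is the potential. *)
Lemma cohomologous_catC Q s1 s2 : enumeration (s1 ++ s2) ->
  cohomologous Q (s1 ++ s2) (s2 ++ s1).
Proof.
by move=> [us sT]; exists (fun x => (x \in s2)%:R) => x y _; apply: before_catC.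
Qed.

Lemma cohomologous_associated Q s s' : enumeration s -> associated s s' ->
  cohomologous Q s s'.
Proof.
move=> es [k ->]; rewrite -{1}(cat_take_drop k s).
by apply: cohomologous_catC; rewrite cat_take_drop.
Qed.

Lemma cohomologous_swap Q u v s : enumeration [:: u, v & s] ->
  ~~ arrow Q u v && ~~ arrow Q v u ->
  cohomologous Q [:: u, v & s] [:: v, u & s].
Proof.
move=> [us sT] /andP[nuv nvu]; exists (fun=> 0) => x y a; rewrite addr0 subr0.
have nxx : ~~ arrow Q x x.
  by rewrite /arrow -eqn0Ngt; exact: (forallP (no_loop Q)).
have uv : u != v by move: us; rewrite /= inE negb_or -andbA => /and3P[].
have excl z t : z != t -> ~~ ((z == x) && (t == x)) /\ ~~ ((z == y) && (t == y)).
  by move=> zt; split; apply/negP => /andP[/eqP e /eqP e']; rewrite e e' eqxx in zt.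
have [vx vy] := excl _ _ uv.
have [uxvy vxuy] : ~~ ((u == x) && (v == y)) /\ ~~ ((v == x) && (u == y)).
  by split; apply/negP => /andP[/eqP e /eqP e']; [move: nuv | move: nvu]; rewrite e e' a.
have same z : ~~ ((z == x) && (z == y)).
  by apply/negP => /andP[/eqP e /eqP e']; move: nxx; rewrite -{2}e e' a.
congr (_%:R); congr nat_of_bool; rewrite /before /=.
move: vx vy uxvy vxuy (same u) (same v).
by case: (u == x); case: (v == x); case: (u == y); case: (v == y).
Qed.

(** A rotation changes the order by a coboundary, and a wiggle changes it only on
a pair that no arrow joins. *)
Lemma wiggle_equivalent_cohomologous C C' : wiggle_equivalent C C' ->
  COQ_quiver C' = COQ_quiver C /\
  cohomologous C (ordering C) (ordering C').
Proof.
elim=> {C C'} [C C' [[-> a]|[e [u [v [s [a1 a2 n]]]]]]|C|C C' _ [e c]|C1 C2 C3 _ [e1 c1] _ [e2 c2]].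
- by split=> //; apply: cohomologous_associated => //; apply: ordering_enumeration.
- split=> //; have e1 : enumeration [:: u, v & s].
    by case: a1 => k ->; apply/enumeration_rot/ordering_enumeration.
  apply: cohomologous_trans (cohomologous_associated _ (ordering_enumeration C) a1) _.
  apply: cohomologous_trans (cohomologous_swap e1 n) _.
  by apply/cohomologous_sym/cohomologous_associated; first exact: ordering_enumeration.
- by split=> //; apply: cohomologous_refl.
- by split=> //; rewrite e; apply: cohomologous_sym.
- by rewrite e2 e1; split=> //; apply: cohomologous_trans c1 _; rewrite -e1.
Qed.

(** * Mutation inside a totally proper class *)

Lemma mutate_arrowsE Q v x y : x != v -> y != v ->
  arrows (mutate Q v) (x, y) =
  ((arrows Q (x, y) + arrows Q (x, v) * arrows Q (v, y)) -
   (arrows Q (y, x) + arrows Q (y, v) * arrows Q (v, x)))%N.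
Proof.
by move=> /negbTE xv /negbTE yv; rewrite !ffunE /= xv yv /=.
Qed.

Lemma arrowsxx Q x : arrows Q (x, x) = 0%N.
Proof. exact/eqP/(forallP (no_loop Q)). Qed.

Lemma arrowsN Q x y : (0 < arrows Q (x, y))%N -> arrows Q (y, x) = 0%N.
Proof.
move=> a; have /forallP/(_ y)/orP[/eqP e|/eqP //] := forallP (no_2cycle Q) x.
by rewrite e in a.
Qed.

Lemma mutate_arrows_from Q v x : arrows (mutate Q v) (v, x) = arrows Q (x, v).
Proof.
rewrite !ffunE /= eqxx ?orbT /= arrowsxx muln0 mul0n !addn0.
case: (posnP (arrows Q (x, v))) => [->//|/arrowsN ->]; exact: subn0.
Qed.

Lemma mutate_arrows_to Q v x : arrows (mutate Q v) (x, v) = arrows Q (v, x).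
Proof.
rewrite !ffunE /= eqxx ?orbT /= arrowsxx muln0 mul0n !addn0.
case: (posnP (arrows Q (v, x))) => [->//|/arrowsN ->]; exact: subn0.
Qed.

(** The cut is made just before the first element satisfying [R]. *)
Lemma split_before (P R : pred V) (t : seq V) :
  (forall x y, x \in t -> y \in t -> P x -> R y -> before t x y) ->
  exists t1 t2, [/\ t = t1 ++ t2, forall x, x \in t -> P x -> x \in t1
                  & forall x, x \in t -> R x -> x \in t2].
Proof.
move=> h; exists (take (find R t) t), (drop (find R t) t).
split=> [|x xt Px|x xt Rx]; first by rewrite cat_take_drop.
  rewrite in_take //; case: (boolP (has R t)) => [hR|/hasNfind ->]; last by rewrite index_mem.
  have := nth_find x hR => Rn; have ht : (find R t < size t)%N by rewrite -has_find.
  have := h _ _ xt (mem_nth x ht) Px Rn; rewrite /before => /leq_trans; apply.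
  exact: index_nth.
have : x \in take (find R t) t ++ drop (find R t) t by rewrite cat_take_drop.
rewrite mem_cat => /orP[|//]; rewrite in_take // => /(before_find x).
by rewrite nth_index // Rx.
Qed.

(** The number [u < v] + [v < w] + [w < u] is the same for all rotations, since
the coboundaries cancel around the triangle.  It is 2 in an ordering witnessing
the right turn; in one starting with [v] the first two terms contribute 1, so
the third must be 1 as well. *)
Lemma right_turn_before C u v w t : right_turn C u v w ->
  associated (ordering C) (v :: t) -> u != v -> w != v -> before t w u.
Proof.
case=> s [k ->] /andP[uv vw] [l e] nu nw.
have [uo oT] := ordering_enumeration C.
set o : seq V := ordering C in uv vw e uo oT.
pose turns s' : int :=
  (before s' u v)%:R + (before s' v w)%:R + (before s' w u)%:R.
have R m : turns (rot m o) = turns o.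
  have B x y : ((before (rot m o) x y)%:R : int) =
      (before o x y)%:R + (x \in drop m o)%:R - (y \in drop m o)%:R.
    by rewrite -{2}(cat_take_drop m o) before_catC // cat_take_drop.
  by rewrite /turns !B; ring.
have := R k; rewrite -(R l) -e /turns.
have -> : before (rot k o) u v by [].
have -> : before (rot k o) v w by [].
have -> : before (rot k o) w u = false.
  by apply/negbTE; rewrite /before -leqNgt ltnW // (ltn_trans uv).
rewrite {1 2 3}/before /= eqxx ![v == _]eq_sym (negbTE nu) (negbTE nw) /= ltnS -/(before t w u).
by case: before.
Qed.

(** Properness is available only up to wiggles, so both orderings are described up
to cohomology.  Cutting the cycle so that the in-neighbours come before [v] and
the out-neighbours after it, the proper mutation moves [v] to the very end:
clockwise past its out-neighbours, which are its new in-neighbours. *)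
Lemma totally_proper_mutate C v : totally_proper C ->
  exists C' s1 s2,
    [/\ [/\ totally_proper C', COQ_quiver C' = mutate C v
           & enumeration (s2 ++ v :: s1)],
        cohomologous C (ordering C) (s2 ++ v :: s1),
        cohomologous C' (ordering C') (s2 ++ s1 ++ [:: v]),
        {subset In C v <= s2} & {subset Out C v <= s1}].
Proof.
move=> tp; have [C1 w1 p1] := tp C (rt_refl _ _ _) v.
have [q1 c1] := wiggle_equivalent_cohomologous w1.
have [uo oT] := ordering_enumeration C1.
have [i t et] := rot_to (oT v).
have at1 : associated (ordering C1) (v :: t) by exists i.
have [ut tT] : enumeration (v :: t) by rewrite -et; apply/enumeration_rot/ordering_enumeration.
have nv x : x \in t -> x != v.
  by move=> xt; apply: contraTneq xt => ->; case/andP: ut.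
have [s1 [s2 [e12 o1 i2]]] : exists t1 t2, [/\ t = t1 ++ t2,
    forall x, x \in t -> arrow C v x -> x \in t1
    & forall x, x \in t -> arrow C x v -> x \in t2].
  apply: split_before => x y xt yt ax ay.
  by apply: (@right_turn_before C1 y v x) => //; rewrite ?nv //; apply: p1; rewrite q1.
have inT x : x != v -> x \in t by move=> /negbTE xv; have := tT x; rewrite inE xv.
have o1' x : arrow C v x -> x \in s1.
  move=> a; apply: o1 => //; apply: inT; apply: contraTneq a => ->.
  by rewrite /arrow arrowsxx.
have i2' x : arrow C x v -> x \in s2.
  move=> a; apply: i2 => //; apply: inT; apply: contraTneq a => ->.
  by rewrite /arrow arrowsxx.
have E1 : enumeration (v :: s1 ++ s2) by rewrite -e12.
have E2 : enumeration (s1 ++ v :: s2).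
  have P : perm_eq (s1 ++ v :: s2) (v :: s1 ++ s2) by rewrite -cat1s perm_catCA.
  by case: E1 => us sT; split=> [|x]; rewrite ?(perm_uniq P) ?(perm_mem P).
have sz : size (s1 ++ v :: s2) == #|V|.
  rewrite cardE; apply/eqP/perm_size/uniq_perm; rewrite ?enum_uniq //; case: E2 => // _ h.
  by move=> x; rewrite h mem_enum.
pose C' := @MkCOQ V (mutate C1 v) (Tuple sz) (proj1 E2).
exists C', s1, s2; split.
- split=> //; last 2 first.
  + by rewrite /= q1.
  + by have := enumeration_catC (s1 := v :: s1) E1.
  move=> C'' h; apply: tp; apply: rt_trans h.
  apply: rt_trans (rt_step _ _ _ _ (or_introl w1)) _.
  apply: rt_step; right; exists v; split=> //.
  exists s1, s2; split; rewrite -?e12 //; first by exists 0%N; rewrite rot0.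
  + by move=> x; rewrite inE /arrow mutate_arrows_to q1 => /o1'.
  + by move=> x; rewrite inE /arrow mutate_arrows_from q1 => /i2'.
- apply: cohomologous_trans c1 _; rewrite -q1.
  apply: cohomologous_trans (cohomologous_associated _ (ordering_enumeration C1) at1) _.
  by rewrite e12; apply: (@cohomologous_catC _ (v :: s1)).
- have -> : s2 ++ s1 ++ [:: v] = s2 ++ (s1 ++ [:: v]) by [].
  have := @cohomologous_catC C' (s1 ++ [:: v]) s2; rewrite -catA; exact.
- by move=> x; rewrite inE; apply: i2'.
- by move=> x; rewrite inE; apply: o1'.
Qed.

End Orders.

(** * Invariance of the Alexander polynomial *)

Section Alexander.
Variable V : finType.
Implicit Types (Q : quiver V) (C : COQ V) (s : seq V) (u v w x y z : V).

(** Indexing matrices by the vertices, rather than by positions in an ordering,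
makes the companions of different orderings comparable entrywise. *)
Definition vertex_mx (R : Type) (F : V -> V -> R) : 'M[R]_#|V| :=
  \matrix_(i, j) F (enum_val i) (enum_val j).

Lemma det_reindex (R : comPzRingType) (F : V -> V -> R) (e : 'I_#|V| -> V) :
  injective e -> \det (\matrix_(i, j) F (e i) (e j)) = \det (vertex_mx F).
Proof.
move=> ei; have si : injective (fun i => enum_rank (e i)) by move=> i j /enum_rank_inj /ei.
pose p := perm si.
have -> : \matrix_(i, j) F (e i) (e j) = row_perm p (col_perm p (vertex_mx F)).
  by apply/matrixP => i j; rewrite !mxE !permE !enum_rankK.
rewrite row_permE col_permE !det_mulmx !det_perm odd_permV mulrCA.
by rewrite -signr_addb addbb expr0 mulr1.
Qed.

Lemma mul_vertex_mx (R : pzSemiRingType) (F G : V -> V -> R) :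
  vertex_mx F *m vertex_mx G = vertex_mx (fun x y => \sum_z F x z * G z y).
Proof.
apply/matrixP => i j; rewrite !mxE [RHS](reindex (@enum_val V predT)) /=.
  by apply: eq_bigr => k _; rewrite !mxE.
exact/onW_bij/enum_val_bij.
Qed.

Lemma trmx_vertex_mx (R : Type) (F : V -> V -> R) :
  (vertex_mx F)^T = vertex_mx (fun x y => F y x).
Proof. by apply/matrixP => i j; rewrite !mxE. Qed.

Definition vertex_companion Q s x y : int :=
  (x == y)%:R - (before s x y)%:R * exchange Q x y.

Definition vertex_alexander Q s : {poly int} :=
  let U := map_mx polyC (vertex_mx (vertex_companion Q s)) in \det ('X *: U - U^T).

Lemma exchangexx Q x : exchange Q x x = 0.
Proof. by rewrite /exchange subrr. Qed.

Lemma vertex_alexander_entry Q s i j : enumeration s ->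
  let U := map_mx polyC (vertex_mx (vertex_companion Q s)) in
  ('X *: U - U^T) i j = (i == j)%:R * ('X - 1) -
     (exchange Q (enum_val i) (enum_val j))%:P *
     'X ^+ (before s (enum_val i) (enum_val j)).
Proof.
move=> es /=; rewrite !mxE /vertex_companion (inj_eq enum_val_inj).
rewrite (exchangeC _ (enum_val j)) eq_sym (inj_eq enum_val_inj).
case: (eqVneq i j) => [->|ij].
  by rewrite exchangexx !oppr0 !mulr0 !subr0 mul0r subr0 mul1r mulr1.
rewrite (beforeN es (x := enum_val i)) ?(inj_eq enum_val_inj) //.
by case: (before s _ _) => /=; ring.
Qed.

Lemma index_tnth n (t : n.-tuple V) i : uniq t -> index (tnth t i) t = i.
Proof. by move=> ut; rewrite (tnth_nth (tnth_default t i)) index_uniq // size_tuple. Qed.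

Lemma alexanderE C : alexander C = vertex_alexander C (ordering C).
Proof.
have eo := ordering_enumeration C.
rewrite /alexander /vertex_alexander.
have ei : injective (tnth (ordering C)).
  by apply/tuple_uniqP/ordering_uniq.
set U1 := map_mx _ _; set U2 := map_mx _ _.
pose F x y : {poly int} := 'X * (vertex_companion C (ordering C) x y)%:P -
  (vertex_companion C (ordering C) y x)%:P.
transitivity (\det (\matrix_(i, j) F (tnth (ordering C) i) (tnth (ordering C) j))).
  congr (\det _); apply/matrixP => i j; rewrite /F /vertex_companion !mxE.
  rewrite /before !index_tnth //; try exact: ordering_uniq.
  rewrite !(inj_eq ei) -!val_eqE /=; case: ltngtP => ij /=;
  rewrite ?mul0r ?mul1r ?sub0r ?subr0 //.
rewrite det_reindex //; congr (\det _).
by apply/matrixP => i j; rewrite !mxE.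
Qed.

(** By [vertex_alexander_entry] the two matrices are conjugate under the diagonal
matrix with entries t^(h x).  To stay among polynomials, [h] is shifted by a
constant that makes it nonnegative. *)
Lemma vertex_alexander_cohomologous Q s s' : enumeration s -> enumeration s' ->
  cohomologous Q s s' -> vertex_alexander Q s' = vertex_alexander Q s.
Proof.
move=> es es' [h hP].
pose K := (\sum_z absz (h z))%N.
pose H x := absz (h x + K%:Z).
have HE x : (H x)%:Z = h x + K%:Z.
  rewrite /H gez0_abs //.
  have : (absz (h x) <= K)%N by rewrite /K (bigD1 x) //= leq_addr.
  lia.
pose D : 'M[{poly int}]_#|V| := diag_mx (\row_j 'X ^+ H (enum_val j)).
rewrite /vertex_alexander; set A' := (X in \det X = _); set A := (X in _ = \det X).
have DA : A' *m D = D *m A.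
  apply/matrixP => i j; rewrite mul_mx_diag mul_diag_mx [LHS]mxE [RHS]mxE.
  rewrite /A' /A !vertex_alexander_entry // !mxE.
  case: (eqVneq i j) => [->|ij]; first by rewrite exchangexx !mul0r !subr0 mulrC.
  rewrite !mul0r !sub0r !mulNr mulrN; congr (- _).
  have E : (enum_val i : V) != enum_val j by rewrite (inj_eq enum_val_inj).
  move: (enum_val i) (enum_val j) E => x y E.
  case: (eqVneq (exchange Q x y) 0) => [->|b]; first by rewrite !mul0r mulr0.
  rewrite -mulrA [RHS]mulrCA; congr (_ * _); rewrite -!exprD; congr (_ ^+ _).
  have : (before s' x y)%:R = (before s x y)%:R + h x - h y.
    have : arrow Q x y \/ arrow Q y x.
      move: b; rewrite /exchange /arrow; lia.
    case=> [/hP //|/hP]; rewrite !(@beforeN _ _ x y) //.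
    by case: (before s x y); case: (before s' x y) => /=; lia.
  by have := HE x; have := HE y; case: (before s x y); case: (before s' x y) => /=; lia.
have : \det A' * \det D = \det A * \det D by rewrite -!det_mulmx DA !det_mulmx mulrC.
apply: mulIf; rewrite det_diag; apply/prodf_neq0 => i _; rewrite mxE.
by rewrite expf_neq0 // polyX_eq0.
Qed.

Lemma exchange_mutate Q v x y : x != v -> y != v ->
  exchange (mutate Q v) x y = exchange Q x y
    + (arrows Q (x, v) * arrows Q (v, y))%:Z - (arrows Q (y, v) * arrows Q (v, x))%:Z.
Proof. by move=> xv yv; rewrite /exchange !mutate_arrowsE //; lia. Qed.

Lemma exchange_mutate_vertex Q v y : exchange (mutate Q v) v y = exchange Q y v.
Proof. by rewrite /exchange mutate_arrows_to mutate_arrows_from. Qed.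

(** The companion is the Gram matrix of a bilinear form.  Mutation at [v] changes
the basis by e_x |-> e_x - U_xv e_v for x other than v, and e_v |-> - e_v.  The
sign makes the entries between [v] and its neighbours correct, and it makes the
change of basis an involution, so that its determinant squares to 1.  The result
is the companion for the rotation that starts with [v]. *)
Lemma vertex_alexander_mutate Q v s1 s2 : enumeration (s2 ++ v :: s1) ->
  {subset In Q v <= s2} -> {subset Out Q v <= s1} ->
  vertex_alexander (mutate Q v) (v :: s2 ++ s1) = vertex_alexander Q (s2 ++ v :: s1).
Proof.
move=> es is2 os1; set s := s2 ++ v :: s1.
pose U := vertex_companion Q s.
(* [k] combines both cases of the change of basis: it is [U x v] off [v], and it
   is 2 at [v], because e_v - 2 e_v = - e_v.  Thus P = 1 - k e_v^T, a reflection. *)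
pose k x := U x v + (x == v)%:R.
pose P : 'M[int]_#|V| := vertex_mx (fun x y => (x == y)%:R - k x * (y == v)%:R).
have Uvv : U v v = 1 by rewrite /U /vertex_companion exchangexx eqxx mulr0 subr0.
have PF F : P *m vertex_mx F = vertex_mx (fun x y => F x y - k x * F v y).
  rewrite mul_vertex_mx; apply/matrixP => i j; rewrite !mxE.
  under eq_bigr do rewrite mulrBl; rewrite big_split /= sumrN.
  rewrite (bigD1 (enum_val i)) //= eqxx mul1r big1 ?addr0; last first.
    by move=> z /negbTE zi; rewrite eq_sym zi mul0r.
  rewrite (bigD1 v) //= eqxx mulr1 big1 ?addr0 // => z /negbTE ->.
  by rewrite mulr0 mul0r.
have kv : k v = 2%:R by rewrite /k Uvv eqxx.
have PP : P *m P = 1%:M.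
  rewrite PF; apply/matrixP => i j; rewrite !mxE (inj_eq enum_val_inj).
  by rewrite (eq_sym v) kv; ring.
have e1 : vertex_mx (vertex_companion (mutate Q v) (v :: s2 ++ s1)) =
    P *m vertex_mx U *m P^T.
  rewrite PF -[RHS]trmxK trmx_mul trmxK trmx_vertex_mx PF trmx_vertex_mx.
  apply/matrixP => i j; rewrite !mxE.
  move: (enum_val i) (enum_val j) => x y.
  rewrite Uvv; have [us sT] := es.
  have kx z : z != v -> k z = U z v by rewrite /k => /negbTE ->; rewrite addr0.
  have [-> | xv] := eqVneq x v; have [-> | yv] := eqVneq y v.
  - by rewrite kv Uvv /vertex_companion exchangexx eqxx mulr0 /=; ring.
  - rewrite kv kx // /U /vertex_companion exchange_mutate_vertex exchangexx eqxx.
    rewrite (eq_sym v) (negbTE yv).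
    have -> : before (v :: s2 ++ s1) v y by rewrite /before /= eqxx eq_sym (negbTE yv).
    rewrite (exchangeC _ v y) (beforeN es yv).
    by case: (before s _ _) => /=; ring.
  - rewrite kv kx // /vertex_companion (negbTE xv).
    have -> : before (v :: s2 ++ s1) x v = false by rewrite /before /= eqxx.
    by rewrite Uvv /=; ring.
  rewrite !kx // /U /vertex_companion exchange_mutate // !(eq_sym v) (negbTE xv) (negbTE yv).
  have mem z : z != v -> z \in s2 ++ s1.
    by move=> /negbTE zv; have := sT z; rewrite !mem_cat inE zv.
  have u' : uniq (s2 ++ s1).
    by apply: subseq_uniq us; rewrite cat_subseq // subseq_cons.
  have -> : before (v :: s2 ++ s1) x y = before (s2 ++ s1) x y.
    by rewrite /before /= !(eq_sym v) (negbTE xv) (negbTE yv).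
  have vs2 : v \in s2 = false.
    by apply/negbTE; move: us; rewrite cat_uniq /= negb_or => /and3P[_ /andP[]].
  have arr z : z != v ->
    if z \in s2 then [/\ before s z v, before s v z = false & arrows Q (v, z) = 0%N]
    else [/\ before s z v = false, before s v z & arrows Q (z, v) = 0%N].
    move=> zv; rewrite /s !before_cat // vs2.
    case z2: (z \in s2).
      split=> //; case: (posnP (arrows Q (v, z))) => // a.
      have := os1 z; rewrite inE => /(_ a) z1.
      by move: u'; rewrite cat_uniq => /and3P[_ /hasPn/(_ z z1)]; rewrite /= z2.
    split; rewrite /before /= ?eqxx // ?(eq_sym v) ?(negbTE zv) //.
    case: (posnP (arrows Q (z, v))) => // a.
    by have := is2 z; rewrite inE => /(_ a); rewrite z2.
  have bxy : before s x y = before (s2 ++ s1) x y.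
    exact: before_remove.
  have bxy2 : before (s2 ++ s1) x y =
      if x \in s2 then (if y \in s2 then before s x y else true)
      else if y \in s2 then false else before s x y.
    by rewrite bxy !before_cat ?mem //; do !case: ifP.
  rewrite bxy bxy2; move: (arr x xv) (arr y yv); rewrite /exchange.
  case: (x \in s2) => -[a1 a2 a3]; case: (y \in s2) => -[b1 b2 b3];
    rewrite ?a1 ?a2 ?a3 ?b1 ?b2 ?b3; try case: (before s x y); rewrite /= ?PoszM; ring.
have e2 : vertex_mx (vertex_companion Q s) = vertex_mx U by [].
rewrite /vertex_alexander e1 e2 !map_mxM /= -!map_trmx.
set Pm := map_mx _ P; set Um := map_mx _ (vertex_mx U).
have -> : 'X *: (Pm *m Um *m Pm^T) - (Pm *m Um *m Pm^T)^T =
    Pm *m ('X *: Um - Um^T) *m Pm^T.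
  by rewrite mulmxBr mulmxBl -scalemxAr -scalemxAl !trmx_mul trmxK mulmxA.
rewrite !det_mulmx det_tr mulrAC -det_mulmx -map_mxM /= PP map_mx1 det1 mul1r //.
Qed.

End Alexander.

(** * The Markov invariant when all arrows go forward *)

(** Each factor [N] raises the index by at least one, so the k-th power is
supported where j >= i + k.  In particular, positive powers have zero diagonal
and the n-th power is zero. *)
Lemma strict_upper_exp n (N : 'M[int]_n) k i j :
  (forall i j, 0 <= N i j) -> (forall i j, N i j != 0 -> (i < j)%N) ->
  0 <= (N ^+ k) i j /\ ((N ^+ k) i j != 0 -> (i + k <= j)%N).
Proof.
move=> N0 Nu; elim: k i j => [|k IH] i j.
  rewrite expr0 !mxE addn0; split=> //.
  by case: (eqVneq i j) => [-> _|_ /eqP].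
rewrite exprS -mulmxE !mxE; split.
  by apply: sumr_ge0 => l _; rewrite mulr_ge0 //; case: (IH l j).
apply: contra_neqT => /negbTE ij; apply: big1 => l _.
have [->|/Nu il] := eqVneq (N i l) 0; first by rewrite mul0r.
have [->|/(proj2 (IH l j)) lj] := eqVneq ((N ^+ k) l j) 0; first by rewrite mulr0.
lia.
Qed.

Lemma det_unipotent n (U : 'M[int]_n) : unipotent_upper U -> \det U = 1.
Proof.
move=> Uu; rewrite -det_tr det_trig.
  by apply: big1 => i _; rewrite mxE Uu // eqxx.
apply/is_trig_mxP => i j ij; rewrite mxE Uu ?(ltnW ij) //.
by rewrite -val_eqE /= gtn_eqF.
Qed.

(** With W the sum of the powers of [N], which is the inverse of 1 - N, multiplying
by W turns the determinant into the characteristic polynomial of U^T W, whose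
subleading coefficient is - tr(U^T W) = - n + tr(N^T W).  Since W dominates [N]
entrywise, the last trace is at least the sum of the squares. *)
Lemma unipotent_coefficient_bound n (N : 'M[int]_n) : (0 < n)%N ->
  (forall i j, 0 <= N i j) -> (forall i j, N i j != 0 -> (i < j)%N) ->
  let U := map_mx polyC (1%:M - N) in
  \sum_i \sum_j N i j ^+ 2 <= n%:Z + (\det ('X *: U - U^T))`_n.-1.
Proof.
move=> n0 N0 Nu /=; set U := map_mx polyC _.
pose W := \sum_(k < n.+2) N ^+ k.
have pw k i j := strict_upper_exp k i j N0 Nu.
have UW : (1%:M - N) *m W = 1%:M.
  transitivity (1 - N ^+ n.+2); first by rewrite -[RHS]opprB subrX1 -mulNr opprB.
  have -> : N ^+ n.+2 = 0.
    apply/matrixP => i j; rewrite [RHS]mxE; apply/eqP/negPn/negP => h.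
    have := proj2 (pw n.+2 i j) h; have := ltn_ord j; lia.
  by rewrite subr0.
have dU : \det (1%:M - N) = 1.
  apply: det_unipotent => i j ij; rewrite !mxE.
  have [->|/Nu] := eqVneq (N i j) 0; first by rewrite subr0.
  by rewrite ltnNge ij.
have dW : \det W = 1 by have := congr1 determinant UW; rewrite det_mulmx dU mul1r det1.
have -> : \det ('X *: U - U^T) = char_poly ((1%:M - N)^T *m W).
  rewrite /char_poly /char_poly_mx map_mxM -map_trmx -/U.
  have dW' : \det (map_mx polyC W) = 1 by rewrite det_map_mx dW.
  rewrite -[LHS]mulr1 -dW' -det_mulmx mulmxBl -scalemxAl -map_mxM UW map_mx1.
  by rewrite scalemx1.
rewrite char_poly_trace // linearB /= trmx1 mulmxBl mul1mx linearB /= opprB.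
have -> : \tr W = n%:Z.
  rewrite /W linear_sum /= big_ord_recl expr0 mxtrace1 big1 ?addr0 //.
    by rewrite natz.
  move=> k _; apply: big1 => i _; apply/eqP/negPn/negP => h.
  have := proj2 (pw _ i i) h; rewrite /= /bump /=; lia.
rewrite addrC subrK /mxtrace exchange_big /=; apply: ler_sum => j _.
rewrite mxE; apply: ler_sum => i _; rewrite mxE expr2 ler_wpM2l //.
rewrite /W summxE (bigD1 (Ordinal (isT : (1 < n.+2)%N))) //= expr1 lerDl.
by apply: sumr_ge0 => k _; case: (pw k i j).
Qed.

Section EdgeBound.
Variable V : finType.
Implicit Types (Q : quiver V) (C : COQ V) (s : seq V) (u v w x y z : V).

Definition num_adjacencies Q := #|[set p | arrow Q p.1 p.2]|.

Lemma forward_ordering_bound Q s : enumeration s -> (0 < #|V|)%N ->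
  (forall x y, arrow Q x y -> before s x y) ->
  (num_adjacencies Q)%:Z <= #|V|%:Z + (vertex_alexander Q s)`_(#|V|.-1).
Proof.
move=> es n0 fw.
have sz : size s == #|V|.
  rewrite cardE; apply/eqP/perm_size/uniq_perm; rewrite ?enum_uniq //; case: es => // _ h.
  by move=> x; rewrite h mem_enum.
pose t := Tuple sz.
have ti : injective (tnth t) by apply/tuple_uniqP; case: es.
pose N : 'M[int]_#|V| := \matrix_(i, j) (arrows Q (tnth t i, tnth t j))%:Z.
have bt i j : before s (tnth t i) (tnth t j) = (i < j)%N.
  by rewrite /before !(@index_tnth _ _ t) //; case: es.
have := @unipotent_coefficient_bound _ N n0.
have -> : vertex_alexander Q s = let U := map_mx polyC (1%:M - N) in \det ('X *: U - U^T).
  rewrite /vertex_alexander /=.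
  pose F x y : {poly int} :=
    'X * (vertex_companion Q s x y)%:P - (vertex_companion Q s y x)%:P.
  transitivity (\det (\matrix_(i, j) F (tnth t i) (tnth t j))).
    by rewrite det_reindex //; congr (\det _); apply/matrixP => i j; rewrite !mxE.
  have comp i j : vertex_companion Q s (tnth t i) (tnth t j) = (1%:M - N) i j.
    rewrite !mxE /vertex_companion (inj_eq ti); congr (_ - _).
    case b: (before _ _ _); rewrite /= ?mul1r ?mul0r.
      rewrite /exchange; case: (posnP (arrows Q (tnth t j, tnth t i))) => [->|/fw].
        by rewrite subr0.
      by move: b; rewrite !bt => /ltnW; rewrite leqNgt => /negbTE ->.
    by case: (posnP (arrows Q (tnth t i, tnth t j))) => [->//|/fw]; rewrite b.
  by congr (\det _); apply/matrixP => i j; rewrite mxE /F !comp !mxE.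
move=> H; apply: le_trans (H _ _) => {H}.
- rewrite pair_big /= /num_adjacencies -sum1_card big_mkcond /=.
  rewrite (reindex (fun p : 'I_#|V| * 'I_#|V| => (tnth t p.1, tnth t p.2))) /=; last first.
    apply: onW_bij; apply: inj_card_bij => [[i j] [k l] /= [/ti -> /ti ->] //|].
    by rewrite !card_prod card_ord.
  rewrite -natz natr_sum; apply: ler_sum => -[i j] _; rewrite mxE inE /= /arrow.
  by case: (arrows _ _) => [|m]; rewrite //= expr2; lia.
- by move=> i j; rewrite mxE.
- move=> i j; rewrite mxE -bt => a; apply: fw; rewrite /arrow lt0n.
  by apply: contraNneq a => ->.
Qed.

(** * Connectedness and the number of adjacent pairs *)

(** A set of vertices that is not everything has an edge leaving it; adding its
endpoint gains at least one edge.  The induction grows such a set from one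
vertex. *)
Lemma connected_num_adjacencies Q : (0 < #|V|)%N -> connected Q -> (#|V|.-1 <= num_adjacencies Q)%N.
Proof.
move=> n0 cQ; pose E (S : {set V}) := #|[set p | [&& p.1 \in S, p.2 \in S & arrow Q p.1 p.2]]|.
have [r _] := card_gt0P n0.
have grow k : (k < #|V|)%N -> exists S : {set V}, [/\ r \in S, #|S| = k.+1 & (k <= E S)%N].
  elim: k => [|k IH] kn; first by exists [set r]; rewrite set11 cards1.
  have [S [rS cS ES]] := IH (ltnW kn).
  have [y yS] : exists y, y \notin S.
    apply/existsP; rewrite -negb_forall; apply: contraTN kn => /forallP h.
    have -> : #|V| = #|S| by apply: eq_card => z; rewrite h.
    by rewrite cS ltnn.
  have [a [b [aS bS ab]]] : exists a b, [/\ a \in S, b \notin S & arrow Q a b || arrow Q b a].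
    have /connectP[p] := cQ r y; move: rS; elim: p (r) => [|z p IHp] a aS /=.
      by move=> _ e; rewrite e aS in yS.
    move=> /andP[az pz] e.
    case: (boolP (z \in S)) => zS; first exact: IHp zS pz e.
    by exists a, z.
  exists (b |: S); rewrite inE rS orbT cardsU1 bS cS add1n; split=> //.
  apply: leq_ltn_trans ES _; apply/proper_card/properP; split.
    by apply/subsetP => -[c d]; rewrite !inE /= => /and3P[-> -> ->]; rewrite !orbT.
  case/orP: ab => ab; [exists (a, b) | exists (b, a)]; rewrite !inE /= ?eqxx ?aS ?ab ?orbT //.
  - by rewrite (negbTE bS).
  - by rewrite (negbTE bS).
have [|S [_ _ ES]] := grow #|V|.-1; first by rewrite prednK.
apply: leq_trans ES _; apply/subset_leq_card/subsetP => p; rewrite !inE.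
by case/and3P.
Qed.

(** An arrow [z -> t] can disappear only by cancelling against a path
[t -> v -> z], and then z and t are both joined to [v] after the mutation. *)
Lemma connected_mutate Q v : connected Q -> connected (mutate Q v).
Proof.
move=> cQ x y; have /connectP[p] := cQ x y.
pose e Q : rel V := fun x y => arrow Q x y || arrow Q y x.
have ev z : e Q v z -> e (mutate Q v) v z.
  by rewrite /e /arrow mutate_arrows_to mutate_arrows_from orbC.
have esym Q' z t : e Q' z t = e Q' t z by rewrite /e orbC.
have half z t : arrow Q z t -> connect (e (mutate Q v)) z t.
  move=> a; have ezt : e Q z t by rewrite /e a.
  have [zv|zv] := eqVneq z v; first by rewrite zv in ezt *; apply/connect1/ev.
  have [tv|tv] := eqVneq t v; first by rewrite tv esym in ezt *; apply/connect1; rewrite esym; apply/ev.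
  case: (posnP (arrows Q (t, v) * arrows Q (v, z))%N) => [c0|].
    apply/connect1; rewrite /e /arrow mutate_arrowsE // c0 (arrowsN a) addn0 subn0 addn_gt0.
    by rewrite [(0 < _)%N]a.
  rewrite muln_gt0 => /andP[tv' vz]; apply: (@connect_trans _ _ v).
    by apply/connect1; rewrite esym; apply: ev; rewrite /e [arrow Q v z]vz.
  by apply/connect1; apply: ev; rewrite /e [arrow Q t v]tv' orbT.
have csym : connect_sym (e (mutate Q v)) by apply: sym_connect_sym => z t; apply: esym.
elim: p x => [|z p IH] x /=; first by move=> _ ->; exact: connect0.
move=> /andP[xz pz] ey.
apply: connect_trans (IH _ pz ey); case/orP: xz => /half //.
by rewrite csym.
Qed.

End EdgeBound.

(** * Sums along closed walks *)

Lemma path_belast (T : eqType) (e e' : rel T) x p :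
  (forall y z, y \in belast x p -> z \in p -> e y z -> e' y z) ->
  path e x p -> path e' x p.
Proof.
elim: p x => //= y p IH x H /andP[xy yp]; rewrite H ?mem_head //=.
by apply: IH yp => z t zp tp; apply: H; rewrite inE ?zp ?tp orbT.
Qed.

Lemma sub_cycle_in (T : eqType) (e e' : rel T) c :
  (forall x y, x \in c -> y \in c -> e x y -> e' x y) -> cycle e c -> cycle e' c.
Proof.
case: c => //= x p H; apply: path_belast => y z.
by rewrite belast_rcons mem_rcons; apply: H.
Qed.

Section Walks.
Variables (T : eqType).
Implicit Types (f : T -> T -> int) (e : rel T) (x y : T) (p c : seq T).

Fixpoint walk_sum f x p : int := if p is y :: q then f x y + walk_sum f y q else 0.

(** The walk closes up: the step from the last entry back to the first is
included. *)
Definition cycle_sum f c : int := if c is x :: p then walk_sum f x (rcons p x) else 0.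

Lemma walk_sum_cat f x p q :
  walk_sum f x (p ++ q) = walk_sum f x p + walk_sum f (last x p) q.
Proof. by elim: p x => [|y p IH] x /=; rewrite ?add0r // IH addrA. Qed.

Lemma walk_sum_rcons f x p y :
  walk_sum f x (rcons p y) = walk_sum f x p + f (last x p) y.
Proof. by rewrite -cats1 walk_sum_cat /= addr0. Qed.

Lemma cycle_sum_catC f p q : cycle_sum f (p ++ q) = cycle_sum f (q ++ p).
Proof.
case: p q => [|x p] [|y q] //=; rewrite ?cats0 //=.
by rewrite !rcons_cat !walk_sum_cat /= !walk_sum_rcons; ring.
Qed.

Lemma cycle_sum_rot f k c : cycle_sum f (rot k c) = cycle_sum f c.
Proof. by rewrite cycle_sum_catC cat_take_drop. Qed.

Lemma eq_walk_sum f f' e x p :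
  (forall y z, y \in x :: p -> z \in x :: p -> e y z -> f' y z = f y z) -> path e x p ->
  walk_sum f' x p = walk_sum f x p.
Proof.
elim: p x => //= y p IH x H /andP[xy yp]; rewrite H ?inE ?eqxx ?orbT //; congr (_ + _).
by apply: IH yp => z t zp tp; apply: H; rewrite inE ?zp ?tp orbT.
Qed.

Lemma walk_sum_coboundary f f' h e x p :
  (forall y z, e y z -> f' y z = f y z + h z - h y) -> path e x p ->
  walk_sum f' x p = walk_sum f x p + h (last x p) - h x.
Proof.
move=> H; elim: p x => [|y p IH] x /=; first by rewrite add0r subrr.
by move=> /andP[/H -> /IH ->]; ring.
Qed.

Lemma cycle_sum_coboundary f f' h e c :
  (forall y z, e y z -> f' y z = f y z + h z - h y) -> cycle e c ->
  cycle_sum f' c = cycle_sum f c.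
Proof.
by case: c => //= x p H /(walk_sum_coboundary H) ->; rewrite last_rcons addrK.
Qed.

Lemma walk_sum_rev f x p : (forall y z, f z y = - f y z) ->
  walk_sum f (last x p) (rev (belast x p)) = - walk_sum f x p.
Proof.
move=> fN; elim: p x => [|y p IH] x /=; first by rewrite oppr0.
rewrite rev_cons walk_sum_rcons IH (fN x); case: p {IH} => [|z p] /=.
  by ring.
by rewrite rev_cons last_rcons; ring.
Qed.

Definition chordless e c : bool :=
  [&& uniq c, cycle e c &
    all (fun x => all (fun y => e x y ==> (y == next c x) || (x == next c y)) c) c].

Lemma chordless_rot e k c : chordless e (rot k c) = chordless e c.
Proof.
rewrite /chordless rot_uniq rot_cycle; case: (boolP (uniq c)) => //= u; congr (_ && _).
rewrite (eq_all_r (mem_rot k c)); apply: eq_all => x; rewrite (eq_all_r (mem_rot k c)).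
by apply: eq_all => y; rewrite !next_rot.
Qed.

Lemma chordlessP e c x y : chordless e c -> x \in c -> y \in c -> e x y ->
  y = next c x \/ x = next c y.
Proof.
case/and3P=> _ _ /allP H xc yc exy; have /allP/(_ y yc) := H x xc.
by rewrite exy /= => /orP[] /eqP ->; [left|right].
Qed.

Lemma not_uniq_split c : ~~ uniq c -> exists x p1 p2 p3, c = p1 ++ x :: p2 ++ x :: p3.
Proof.
elim: c => //= z t IH; rewrite negb_and negbK; case: (boolP (z \in t)) => [zt _|_ /=].
  by case/splitPr: zt => p2 p3; exists z, [::], p2, p3.
by case/IH=> x [p1 [p2 [p3 ->]]]; exists x, (z :: p1), p2, p3.
Qed.

(** Strong induction on the length: at a repeated vertex or along a chord a closed
walk splits into two shorter ones.  The two traversals of the chord cancel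
because [f] is antisymmetric. *)
Lemma cycle_sum_eq0 f e :
  irreflexive e -> symmetric e -> (forall x y, f y x = - f x y) ->
  (forall c, chordless e c -> cycle_sum f c = 0) ->
  forall c, cycle e c -> cycle_sum f c = 0.
Proof.
move=> eI eS fN H c; move: {-1}(size c) (leqnn (size c)) => n.
elim: n c => [|n IH] c; first by case: c.
move=> cn cc; case: (boolP (uniq c)) => [uc|/not_uniq_split[x [p1 [p2 [p3 E]]]]]; last first.
  have R : rot (size p1) c = (x :: p2) ++ (x :: p3 ++ p1).
    by rewrite E rot_size_cat /= -catA.
  rewrite -(cycle_sum_rot _ (size p1)) R; move: cc; rewrite -(rot_cycle (size p1)) R.
  have := cn; rewrite -(size_rot (size p1)) R => sz.
  rewrite /= rcons_cat cat_path /= walk_sum_cat /= => /and3P[h1 h2 h3].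
  have E1 : cycle_sum f (x :: p2) = 0.
    apply: IH; last by rewrite /= rcons_path h1.
    by move: sz; rewrite /= !size_cat /=; lia.
  have E2 : cycle_sum f (x :: p3 ++ p1) = 0.
    apply: IH; last by rewrite /= h3.
    by move: sz; rewrite /= !size_cat /= ?size_cat; lia.
  by move: E1 E2; rewrite /= walk_sum_rcons => E1 ->; rewrite addr0.
case: (boolP (chordless e c)) => [/H //|]; rewrite /chordless uc cc /=.
case/allPn=> x xc /allPn[y yc]; rewrite negb_imply negb_or => /and3P[exy nxy nyx].
have [i t R] := rot_to xc; have nr := next_rot i uc; move: cc cn nxy nyx uc yc.
rewrite -(mem_rot i) -!nr -(rot_uniq i) -(rot_cycle i) -(size_rot i) -(cycle_sum_rot _ i).
rewrite {}R [y \in _]inE; case: (eqVneq y x) => [E|_ /=]; first by rewrite E eI in exy.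
move=> cc cn nxy nyx uc yt; case/splitPr: yt cc cn nxy nyx uc => t1 t2.
case: t1 => [|z t1]; first by rewrite /= !eqxx.
case: t2 => [|w t2] cc cn _ nyx uc.
  have uc' : uniq ((x :: z :: t1) ++ [:: y]) by [].
  have nE : next ((x :: z :: t1) ++ [:: y]) y = x.
    by rewrite -[LHS](next_rot (size (x :: z :: t1)) uc') rot_size_cat /= eqxx.
  by case/negP: nyx; apply/eqP/esym.
move: cc; rewrite /= rcons_cat cat_path /= => /and5P[h1 h2 h3 h4 h5].
have E1 : cycle_sum f (x :: rcons (z :: t1) y) = 0.
  apply: IH; last by rewrite /= h1 !rcons_path h2 last_rcons h3 eS exy.
  by move: cn; rewrite /= !(size_cat, size_rcons) /=; lia.
have E2 : cycle_sum f (y :: rcons (w :: t2) x) = 0.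
  apply: IH; last by rewrite /= h4 rcons_path h5 last_rcons exy.
  by move: cn; rewrite /= !(size_cat, size_rcons) /=; lia.
move: E1 E2; rewrite /= !walk_sum_cat /= !walk_sum_rcons !last_rcons (fN x y) => E1 E2.
by rewrite -[RHS]addr0 -{1}E1 -E2; ring.
Qed.

End Walks.

(** The potential at x is the sum along a chosen path from the root of its
component.  For an edge [x, y], going to x, along the edge, and back from y is a
closed walk. *)
Lemma potential (V : finType) (f : V -> V -> int) (e : rel V) :
  symmetric e -> (forall x y, f y x = - f x y) ->
  (forall c, cycle e c -> cycle_sum f c = 0) ->
  exists g : V -> int, forall x y, e x y -> f x y = g y - g x.
Proof.
move=> eS fN H.
have closed z t : path e z t -> last z t = z -> walk_sum f z t = 0.
  case/lastP: t => [//|t w] zt; rewrite last_rcons => e1; rewrite e1 in zt *.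
  exact: (H (z :: t)).
have cS : connect_sym e by apply: sym_connect_sym.
have P x : exists p, path e (fingraph.root e x) p && (x == last (fingraph.root e x) p).
  have := connect_root e x; rewrite cS => /connectP[p h1 h2].
  by exists p; rewrite h1 -h2 eqxx.
pose p x := xchoose (P x).
have pP x : path e (fingraph.root e x) (p x) /\ last (fingraph.root e x) (p x) = x.
  by have /andP[h1 /eqP <-] := xchooseP (P x).
exists (fun x => walk_sum f (fingraph.root e x) (p x)) => x y exy.
have rE : fingraph.root e y = fingraph.root e x by apply/esym/(fingraph.rootP cS)/connect1.
have [px lx] := pP x; have [py ly] := pP y; rewrite rE in py ly *.
set r := fingraph.root e x in px lx py ly *.
have h : walk_sum f r (p x ++ y :: rev (belast r (p y))) = 0.
  apply: closed.
    rewrite cat_path px lx /= exy -{1}ly rev_path /=.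
    by rewrite (eq_path (e' := e)) // => a b /=; rewrite eS.
  rewrite last_cat /=; case: (p y) ly => [|b q] /=; first by move=> ->.
  by rewrite rev_cons last_rcons.
move: h; rewrite walk_sum_cat lx /= -{2}ly walk_sum_rev //.
by move/eqP; rewrite addrA subr_eq0 addrC => /eqP <-; rewrite addrK.
Qed.

(** * Shortening a chordless cycle by mutation *)

Lemma eq_chordless (T : eqType) (e1 e2 : rel T) c : e1 =2 e2 ->
  chordless e1 c = chordless e2 c.
Proof.
move=> E; rewrite /chordless (eq_cycle E); congr [&& _, _ & _].
by apply: eq_all => p; apply: eq_all => q; rewrite E.
Qed.

(** Only the multiplicities along the cycle matter here.  They are abstract
functions [a] and [a'], before and after the mutation at [u], so that the lemmas
apply to a quiver and to its opposite alike. *)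
Section Shorten.
Variables (V : eqType) (a a' : V -> V -> nat) (u x y : V) (r : seq V).
Let A p q := (0 < a p q)%N.
Let A' p q := (0 < a' p q)%N.
Let e p q := A p q || A q p.
Let e' p q := A' p q || A' q p.
Hypothesis no2 : forall p q, A p q -> a q p = 0%N.
Hypothesis no2' : forall p q, A' p q -> a' q p = 0%N.
Hypothesis a'E : forall p q, p != u -> q != u ->
  a' p q = ((a p q + a p u * a u q) - (a q p + a q u * a u p))%N.
Let c := [:: x, u, y & r].
Let c' := [:: x, y & r].
Hypothesis ch : chordless e c.
Hypothesis no : ~~ cycle A c.
Hypothesis xu : A x u.
Hypothesis uy : A u y.

Let ucP : [/\ x != u, x != y, u != y, x \notin r & [/\ u \notin r, y \notin r & uniq r]].
Proof.
have /and3P[] := ch; rewrite /c /= !inE !negb_or => /and4P[/and3P[-> -> ->]].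
by move=> /andP[-> ->] -> ->.
Qed.

Let sub p : p \in c' -> p \in c.
Proof. by rewrite !inE => /or3P[] ->; rewrite ?orbT. Qed.

Let ne_u p : p \in c' -> p != u.
Proof.
have [xu' _ uy' _ [ur _ _]] := ucP.
by rewrite !inE => /or3P[/eqP ->|/eqP ->|pr]; rewrite // 1?eq_sym //; apply: contraNneq ur => ->.
Qed.

Let nextE p : p \in c' -> p != x -> next c p = next c' p.
Proof. by move=> /ne_u pu px; rewrite /c /c' /= (negbTE px) (negbTE pu). Qed.

Let next_u p : p \in c' -> next c p = u -> p = x.
Proof.
move=> pc; have /and3P[uc _ _] := ch => h.
by apply: (can_inj (prev_next uc)); rewrite h /= eqxx.
Qed.

Let next_cu : next c u = y.
Proof. by have [xu' _ _ _ _] := ucP; rewrite /c /= [u == x]eq_sym (negbTE xu') eqxx. Qed.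

Let into_u p : p \in c' -> A p u -> p = x.
Proof.
move=> pc pu; have := chordlessP ch (sub pc) (_ : u \in c); rewrite !inE eqxx orbT => /(_ isT).
rewrite /e pu => /(_ isT)[/esym/next_u-> //|]; rewrite next_cu => e1.
by have := no2 uy; move: pu; rewrite /A e1 => + e2; rewrite e2.
Qed.

Let outof_u p : p \in c' -> A u p -> p = y.
Proof.
move=> pc up; have := chordlessP ch (sub pc) (_ : u \in c); rewrite !inE eqxx orbT => /(_ isT).
rewrite /e up orbT => /(_ isT)[/esym/next_u e1|]; last by rewrite next_cu.
by have := no2 xu; move: up; rewrite e1 ?inE // => /[swap]; rewrite /A => ->.
Qed.

(** An arrow [y -> x] would be an edge of the cycle, which would then be the
oriented triangle [x -> u -> y -> x]. *)
Let not_yx : a y x = 0%N.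
Proof.
case: (posnP (a y x)) => // yx; exfalso.
have [xu' xy uy' xr [_ yr _]] := ucP.
have := chordlessP ch (_ : y \in c) (_ : x \in c); rewrite !inE !eqxx !orbT => /(_ isT isT).
rewrite /e [A y x]yx => /(_ isT)[]; last by rewrite /= eqxx => e1; rewrite e1 eqxx in uy'.
rewrite /= ![y == _]eq_sym (negbTE xy) (negbTE uy'); move: no xr.
rewrite /c; case: r => [|z t] /=.
  by rewrite xu uy [A y x]yx.
by rewrite eqxx inE => _ /norP[/negP + _] e1; rewrite e1 eqxx.
Qed.

Lemma shorten_arrow : A' x y.
Proof.
have [xu' _ uy' _ _] := ucP.
rewrite /A' a'E // 1?eq_sym // not_yx (no2 xu) muln0 addn0 subn0.
by rewrite addn_gt0 muln_gt0 [X in X && _]xu [X in _ && X]uy orbT.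
Qed.

(** An arrow of the shortened cycle can be cancelled only by a new arrow, and the
only new one is [x -> y], whose opposite is absent. *)
Lemma shorten_arrows p q : p \in c' -> q \in c' -> A p q -> A' p q.
Proof.
move=> pc qc pq; rewrite /A' a'E ?ne_u // (no2 pq) add0n.
case: (posnP (a q u * a u p)%N) => [->|]; first by rewrite subn0 addn_gt0 [X in X || _]pq.
rewrite muln_gt0 => /andP[/(into_u qc) e1 /(outof_u pc) e2].
by move: pq; rewrite /A e1 e2 not_yx.
Qed.

Lemma shorten_arrows_inv p q : p \in c' -> q \in c' -> A' p q ->
  A p q \/ p = x /\ q = y.
Proof.
move=> pc qc; rewrite /A' a'E ?ne_u // => h.
case: (posnP (a p u * a u q)%N) => h1.
  left; move: h; rewrite h1 /A; lia.
by right; move: h1; rewrite muln_gt0 => /andP[/(into_u pc) -> /(outof_u qc) ->].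
Qed.

Lemma shorten_edges p q : p \in c' -> q \in c' -> e p q -> e' p q.
Proof. by move=> pc qc; rewrite /e /e' => /orP[] /shorten_arrows->; rewrite ?orbT. Qed.

Lemma shorten_chordless : chordless e' c'.
Proof.
have [xu' xy uy' xr [ur yr ut]] := ucP.
have tr p q : p \in c' -> q \in c' -> q = next c p -> q = next c' p.
  move=> pc qc; have [->|px] := eqVneq p x; last by rewrite nextE.
  by rewrite /= eqxx => e1; move: (ne_u qc); rewrite e1 eqxx.
apply/and3P; split.
- by rewrite /= inE negb_or xy xr yr ut.
- have /and3P[_ /= /and3P[_ _ h] _] := ch.
  rewrite /e' shorten_arrow /=; apply: path_belast h => p q.
  rewrite belast_rcons mem_rcons => pc qc; apply: shorten_edges.
    by rewrite /c' inE pc orbT.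
  by move: qc; rewrite /c' !inE => /orP[] ->; rewrite ?orbT.
apply: (introT allP) => p pc; apply: (introT allP) => q qc; apply/implyP => pq.
have : [\/ e p q, p = x /\ q = y | p = y /\ q = x].
  case/orP: pq => /shorten_arrows_inv.
    by case=> // [h|h]; [constructor 1; rewrite /e h | constructor 2].
  by case=> // [h|[-> ->]]; [constructor 1; rewrite /e h orbT | constructor 3].
case=> [h|[-> ->]|[-> ->]]; last 2 first.
- by rewrite /= eqxx eqxx.
- by rewrite orbC /= eqxx eqxx.
by case: (chordlessP ch (sub pc) (sub qc) h) => /tr <- //; rewrite eqxx ?orbT.
Qed.

(** An oriented shortened cycle would come from the oriented cycle obtained by
reinserting [u]. *)
Lemma shorten_noncyclic : ~~ cycle A' c'.
Proof.
have [xu' xy uy' xr [ur yr ut]] := ucP.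
apply: contra no => /= /andP[_ h]; rewrite xu uy /=.
apply: path_belast h => p q; rewrite belast_rcons mem_rcons => pc qc.
case/shorten_arrows_inv => //.
- by rewrite /c' inE pc orbT.
- by move: qc; rewrite /c' !inE => /orP[] ->; rewrite ?orbT.
by case=> e1; move: pc; rewrite e1 inE (negbTE xy) (negbTE xr).
Qed.

Lemma shorten_noncyclic_op : ~~ cycle (fun p q => A' q p) c'.
Proof. by rewrite /= /A' (no2' shorten_arrow). Qed.

End Shorten.

(** * Winding numbers in a totally proper class *)

Section Winding.
Variable V : finType.
Implicit Types (Q : quiver V) (C : COQ V) (s c : seq V) (u v w x y z : V).

Definition edge Q : rel V := fun x y => arrow Q x y || arrow Q y x.

(** The signed number of times that the step from [x] to [y] passes the point
where the cyclic ordering is cut open: an arrow is followed clockwise, and a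
reversed arrow counterclockwise. *)
Definition winding_step Q s x y : int :=
  if arrow Q x y then (before s y x)%:R
  else if arrow Q y x then - (before s x y)%:R else 0.

Lemma arrow_asym Q x y : arrow Q x y -> arrow Q y x = false.
Proof. by rewrite {2}/arrow => /arrowsN ->. Qed.

Lemma edge_sym Q : symmetric (edge Q).
Proof. by move=> x y; rewrite /edge orbC. Qed.

Lemma arrowxx Q x : arrow Q x x = false.
Proof. by rewrite /arrow arrowsxx. Qed.

Lemma edge_irreflexive Q : irreflexive (edge Q).
Proof. by move=> x; rewrite /edge arrowxx. Qed.

Lemma winding_stepN Q s x y : winding_step Q s y x = - winding_step Q s x y.
Proof.
rewrite /winding_step; case xy: (arrow Q x y); first by rewrite (arrow_asym xy).
by case yx: (arrow Q y x); rewrite ?opprK ?oppr0.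
Qed.

Lemma arrow_neq Q x y : arrow Q x y -> x != y.
Proof. by apply: contraTneq => ->; rewrite arrowxx. Qed.

Lemma winding_cohomologous Q s s' c : enumeration s -> enumeration s' ->
  cohomologous Q s s' -> cycle (edge Q) c ->
  cycle_sum (winding_step Q s') c = cycle_sum (winding_step Q s) c.
Proof.
move=> es es' [h hP]; apply: (cycle_sum_coboundary (h := h)) => x y.
have H z t : arrow Q z t -> winding_step Q s' z t = winding_step Q s z t + h t - h z.
  move=> zt; rewrite /winding_step zt; have := hP _ _ zt.
  rewrite !(@beforeN _ _ z t) ?(arrow_neq zt) //.
  by case: (before s z t); case: (before s' z t) => /=; lia.
case/orP=> [/H //|/H]; rewrite (winding_stepN Q s' y) (winding_stepN Q s y) => ->; ring.
Qed.

Definition winding C c : int := cycle_sum (winding_step C (ordering C)) c.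

(** A chordless cycle that is an oriented cycle in neither direction.  Such cycles
are the minimal possible carriers of nonzero winding in an acyclic quiver, and,
unlike acyclicity, this property survives the mutations used below. *)
Definition unoriented_hole Q c := [&& chordless (edge Q) c, ~~ cycle (arrow Q) c &
  ~~ cycle (fun x y => arrow Q y x) c].

Lemma unoriented_hole_rot Q k c : unoriented_hole Q (rot k c) = unoriented_hole Q c.
Proof. by rewrite /unoriented_hole chordless_rot !rot_cycle. Qed.

Lemma unoriented_hole_cycle Q c : unoriented_hole Q c -> cycle (edge Q) c.
Proof. by case/and3P=> /and3P[]. Qed.

Definition directed_turn Q x u y : bool :=
  arrow Q x u && arrow Q u y || arrow Q y u && arrow Q u x.

Section MutatedWinding.
Variables (Q : quiver V) (v : V) (s1 s2 : seq V).
Hypothesis es : enumeration (s2 ++ v :: s1).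
Hypothesis is2 : {subset In Q v <= s2}.
Hypothesis os1 : {subset Out Q v <= s1}.
Let s := s2 ++ v :: s1.
Let s' := s2 ++ s1 ++ [:: v].
Let Q' := mutate Q v.

Lemma enumeration_mutated : enumeration s'.
Proof.
have P : perm_eq s' s by rewrite perm_cat2l perm_catC.
by case: es => us sT; split=> [|x]; rewrite ?(perm_uniq P) ?(perm_mem P).
Qed.

Let disj : [/\ v \notin s2, v \notin s1 & forall x, x \in s1 -> x \in s2 = false].
Proof.
case: es; rewrite cat_uniq /= negb_or => /and3P[_ /andP[v2 /hasPn h] /andP[v1 _]] _.
by split=> // x /h /negbTE.
Qed.

Lemma before_vertex_in x : arrow Q x v -> before s v x = false.
Proof.
move=> xv; have := is2 (_ : x \in In Q v); rewrite inE => /(_ xv) x2.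
have [us sT] := es; have [/negbTE v2 _ _] := disj.
by rewrite before_cat // v2 x2.
Qed.

Lemma before_out_vertex x : arrow Q v x -> before s x v = false.
Proof.
move=> vx; have := os1 (_ : x \in Out Q v); rewrite inE => /(_ vx) x1.
have [us sT] := es; have [/negbTE v2 _ h] := disj.
by rewrite before_cat // v2 (h _ x1) /before /= eqxx.
Qed.

Lemma before_mutated_vertex x : before s' v x = false.
Proof.
have [us sT] := enumeration_mutated; have [/negbTE v2 /negbTE v1 _] := disj.
rewrite /s' catA before_cat -?catA // mem_cat v1 v2 /=.
case: ifP => // xn; have := sT x; rewrite /s' catA mem_cat xn inE => /eqP ->.
by rewrite /before ltnn.
Qed.

Lemma before_mutated_out_in x y :
  arrow Q x v -> arrow Q v y -> before s' y x = false.
Proof.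
move=> xv vy; have [us sT] := enumeration_mutated; have [_ _ h] := disj.
have := is2 (_ : x \in In Q v); rewrite inE => /(_ xv) x2.
have := os1 (_ : y \in Out Q v); rewrite inE => /(_ vy) y1.
by rewrite before_cat // x2 (h _ y1).
Qed.

Lemma before_mutated_other x y : x != v -> y != v -> before s' x y = before s x y.
Proof.
move=> xv yv; have [us sT] := es; have [us' sT'] := enumeration_mutated.
rewrite [RHS]before_remove // /s' catA before_remove ?cats0 -?catA //.
Qed.

(** No edge at [v] wraps around: in-neighbours come before [v] and out-neighbours
after it. *)
Lemma winding_step_vertex x : winding_step Q s x v = 0.
Proof.
rewrite /winding_step; case xv: (arrow Q x v); first by rewrite before_vertex_in.
by case vx: (arrow Q v x); rewrite // before_out_vertex // oppr0.
Qed.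

Lemma winding_step_same x y : x != v -> y != v -> edge Q x y ->
  (arrow Q x y -> arrow Q' x y) -> (arrow Q y x -> arrow Q' y x) ->
  winding_step Q' s' x y = winding_step Q s x y.
Proof.
move=> xv yv exy h1 h2; rewrite /winding_step !before_mutated_other //.
case/orP: exy => a; first by rewrite a h1.
by rewrite (arrow_asym (h2 a)) (arrow_asym a) a h2.
Qed.

Lemma winding_step_in_out x y : arrow Q x v -> arrow Q v y -> arrow Q' x y ->
  winding_step Q' s' x y = 0.
Proof. by move=> xv vy a; rewrite /winding_step a before_mutated_out_in. Qed.

Lemma winding_step_source x : arrow Q v x -> winding_step Q' s' x v = 0.
Proof.
move=> vx; rewrite /winding_step {1}/arrow mutate_arrows_to [(0 < _)%N]vx.
by rewrite before_mutated_vertex.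
Qed.

End MutatedWinding.

(** Before the mutation the two steps at [u] do not wrap around, and after it the
arrow between [x] and [y] does not either, while all other steps are unchanged;
so dropping [u] keeps the winding.  The path through [u] may run along the list
or against it; the second case is the first one for the opposite quiver. *)
Lemma shorten_at_turn C x u y r :
  totally_proper C -> unoriented_hole C [:: x, u, y & r] ->
  directed_turn C x u y ->
  exists C', [/\ totally_proper C', unoriented_hole C' [:: x, y & r] &
    winding C' [:: x, y & r] = winding C [:: x, u, y & r]].
Proof.
move=> tp g dir; have [C' [s1 [s2 [[tp' q' es] c1 c2 i2 o1]]]] := totally_proper_mutate u tp.
exists C'; have /and3P[ch n1 n2] := g.
have no2 (Q : quiver V) p q : (0 < arrows Q (p, q))%N -> arrows Q (q, p) = 0%N.
  exact: arrowsN.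
pose a p q := arrows C (p, q); pose a' p q := arrows (mutate C u) (p, q).
have a'E p q : p != u -> q != u ->
    a' p q = ((a p q + a p u * a u q) - (a q p + a q u * a u p))%N.
  exact: mutate_arrowsE.
set s := s2 ++ u :: s1 in es c1; set s' := s2 ++ s1 ++ [:: u] in c2.
rewrite /winding q' in c2 *.
have [g' arr wxy] : [/\ unoriented_hole (mutate C u) [:: x, y & r],
     {in [:: x, y & r] &, forall p q, arrow C p q -> arrow (mutate C u) p q} &
     winding_step (mutate C u) s' x y = 0].
  case/orP: dir => /andP[d1 d2].
    split; first (apply/and3P; split).
    - exact: (@shorten_chordless _ a a' u x y r (@no2 _) a'E ch n1 d1 d2).
    - exact: (@shorten_noncyclic _ a a' u x y r (@no2 _) a'E ch n1 d1 d2).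
    - exact: (@shorten_noncyclic_op _ a a' u x y r (@no2 _) (@no2 _) a'E ch n1 d1 d2).
    - by move=> p q pc qc; apply: (@shorten_arrows _ a a' u x y r (@no2 _) a'E ch n1 d1 d2).
    - apply: winding_step_in_out => //.
      exact: (@shorten_arrow _ a a' u x y r (@no2 _) a'E ch n1 d1 d2).
  pose b p q := a q p; pose b' p q := a' q p.
  have b'E p q : p != u -> q != u ->
      b' p q = ((b p q + b p u * b u q) - (b q p + b q u * b u p))%N.
    by move=> pu qu; rewrite /b' a'E // /b mulnC (mulnC (a p u)).
  have esym (Q : quiver V) : edge Q =2 (fun p q => arrow Q q p || arrow Q p q).
    by move=> p q; rewrite /edge orbC.
  have chb := ch; rewrite (eq_chordless _ (esym C)) in chb.
  have B1 p q : (0 < b p q)%N -> b q p = 0%N by apply: no2.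
  have B2 p q : (0 < b' p q)%N -> b' q p = 0%N by apply: no2.
  split; first (apply/and3P; split).
  - rewrite (eq_chordless _ (esym _)).
    exact: (@shorten_chordless _ b b' u x y r B1 b'E chb n2 d2 d1).
  - exact: (@shorten_noncyclic_op _ b b' u x y r B1 B2 b'E chb n2 d2 d1).
  - exact: (@shorten_noncyclic _ b b' u x y r B1 b'E chb n2 d2 d1).
  - by move=> p q pc qc; apply: (@shorten_arrows _ b b' u x y r B1 b'E chb n2 d2 d1).
  - rewrite winding_stepN winding_step_in_out ?oppr0 //.
    exact: (@shorten_arrow _ b b' u x y r B1 b'E chb n2 d2 d1).
split=> //.
have eo := ordering_enumeration C; have eo' := ordering_enumeration C'.
rewrite -(winding_cohomologous eo' (enumeration_mutated es) c2) ?unoriented_hole_cycle //.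
rewrite -(winding_cohomologous eo es c1) ?unoriented_hole_cycle //.
rewrite /= wxy (winding_step_vertex es) // winding_stepN (winding_step_vertex es) // oppr0 !add0r.
have /and3P[/and3P[uc]] := g; rewrite /= => /and3P[_ _ pth] _ _ _.
apply: eq_walk_sum pth => p q pc qc pq.
have sub z : z \in y :: rcons r x -> z \in [:: x, y & r].
  by rewrite !inE mem_rcons !inE => /or3P[] ->; rewrite ?orbT.
have nu z : z \in y :: rcons r x -> z != u.
  move/sub => zc; apply: contraTneq zc => ->.
  by move: uc; rewrite /= !inE !negb_or => /and3P[/and3P[+ _ _] /andP[-> ->] _]; rewrite eq_sym => ->.
by apply: winding_step_same; rewrite ?nu //; apply: arr; apply: sub.
Qed.

End Winding.

Section WindingVanishes.
Variable V : finType.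
Implicit Types (Q : quiver V) (C : COQ V) (s c : seq V) (u v w x y z : V).

Lemma hole_neighbours Q x v y r z :
  unoriented_hole Q [:: x, v, y & r] -> z \in [:: x, v, y & r] ->
  edge Q z v -> z = x \/ z = y.
Proof.
case/and3P=> ch _ _ zc ezv; have /and3P[uc _ _] := ch.
have vc : v \in [:: x, v, y & r] by rewrite !inE eqxx orbT.
have xv : x != v by move: uc; rewrite /= !inE negb_or => /andP[/andP[]].
case: (chordlessP ch zc vc ezv) => h; [left|right].
  by apply: (can_inj (prev_next uc)); rewrite -h /= eqxx.
by rewrite h /= [v == x]eq_sym (negbTE xv) eqxx.
Qed.

(** Mutation at a vertex that is a source of the cycle only reverses its two
arrows there.  Neither of them wraps around before or after, so the winding is
kept. *)
Lemma mutate_at_source C x v y r :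
  totally_proper C -> unoriented_hole C [:: x, v, y & r] ->
  arrow C v x -> arrow C v y ->
  exists C', [/\ totally_proper C', unoriented_hole C' [:: x, v, y & r],
    winding C' [:: x, v, y & r] = winding C [:: x, v, y & r],
    arrow C' x v &
    forall p, p \in y :: r -> arrow C p x -> arrow C' p x].
Proof.
move=> tp g vx vy; have [C' [s1 [s2 [[tp' q' es] c1 c2 i2 o1]]]] := totally_proper_mutate v tp.
exists C'; rewrite /winding q' in c2 *; set c := [:: x, v, y & r] in g *.
have /and3P[ch _ _] := g; have /and3P[uc cc _] := ch.
have [xv vr] : x != v /\ v \notin y :: r.
  by move: uc; rewrite /= !inE !negb_or => /andP[/and3P[-> _ _] /andP[-> _]].
have inv p : p \in c -> arrow C p v = false.
  move=> pc; apply/negP => pv; have := hole_neighbours g pc (_ : edge C p v).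
  by rewrite /edge pv => /(_ isT)[] e; move: pv; rewrite e;
    rewrite ?(arrow_asym vx) ?(arrow_asym vy).
have same p q : p \in c -> q \in c -> p != v -> q != v -> arrow (mutate C v) p q = arrow C p q.
  move=> pc qc pv qv; rewrite /arrow mutate_arrowsE //.
  have z t : t \in c -> arrows C (t, v) = 0%N.
    by move/inv; rewrite /arrow; case: (arrows _ _).
  rewrite !z // !mul0n !addn0; case: (posnP (arrows C (p, q))) => [->|a].
    by rewrite sub0n.
  by rewrite (arrowsN a) subn0 a.
have out p : arrow (mutate C v) p v = arrow C v p by rewrite /arrow mutate_arrows_to.
have into p : arrow (mutate C v) v p = arrow C p v by rewrite /arrow mutate_arrows_from.
have eq p q : p \in c -> q \in c -> edge (mutate C v) p q = edge C p q.
  move=> pc qc; have [->|pv] := eqVneq p v; first by rewrite /edge out into orbC.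
  have [->|qv] := eqVneq q v; first by rewrite /edge out into orbC.
  by rewrite /edge !same.
have ne p : p \in y :: r -> p != v by move=> pr; apply: contraNneq vr => <-.
have sub p : p \in y :: r -> p \in c by rewrite !inE => /orP[] ->; rewrite ?orbT.
have xc : x \in c by rewrite inE eqxx.
have g' : unoriented_hole (mutate C v) c.
  apply/and3P; split; last 2 first.
  - by rewrite /= out into vx inv ?sub ?mem_head.
  - by rewrite /= into inv.
  apply/and3P; split=> //.
    by apply: sub_cycle_in cc => p q pc qc; rewrite eq.
  have /and3P[_ _ /allP h] := ch; apply: (introT allP) => p pc; apply: (introT allP) => q qc.
  by rewrite eq //; apply: (allP (h p pc)).
split=> //; first last.
- by move=> p pr px; rewrite same ?(ne _ pr) ?(sub _ pr).
- by rewrite out.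
have eo := ordering_enumeration C; have eo' := ordering_enumeration C'.
rewrite -(winding_cohomologous eo' (enumeration_mutated es) c2) ?unoriented_hole_cycle //.
rewrite -(winding_cohomologous eo es c1) ?unoriented_hole_cycle //.
rewrite /c /= !(winding_step_source es) // !(winding_step_vertex es) //.
rewrite ![winding_step _ _ v y]winding_stepN.
rewrite !(winding_step_source es) // !(winding_step_vertex es) //.
congr (_ + (_ + _)).
have : path (edge C) y (rcons r x) by move: cc; rewrite /c /= => /and3P[].
apply: eq_walk_sum => p q pc qc pq.
have sub' z : z \in y :: rcons r x -> z \in c /\ z != v.
  rewrite inE mem_rcons inE => /or3P[/eqP ->|/eqP ->|zr]; first by rewrite ne ?mem_head ?sub ?mem_head.
    by [].
  by have zr' : z \in y :: r; rewrite ?ne ?sub // inE zr orbT.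
have [pc' pv] := sub' _ pc; have [qc' qv] := sub' _ qc.
by apply: winding_step_same => //; rewrite same.
Qed.

(** Without a directed turn every vertex of the cycle is a source or a sink of it.
Take a source [v] and the sink [x] next to it, and let [z] be the other
neighbour of [x]: mutating at [v] produces the path [z -> x -> v]. *)
Lemma exists_directed_turn C c :
  totally_proper C -> unoriented_hole C c -> (2 < size c)%N ->
  exists C' x u y r, [/\ totally_proper C', unoriented_hole C' [:: x, u, y & r],
    size [:: x, u, y & r] = size c,
    winding C' [:: x, u, y & r] = winding C c
  & directed_turn C' x u y].
Proof.
move=> tp g sc.
pose P k := if rot k c is [:: x, u, y & r] then directed_turn C x u y else false.
have [[k Pk]|none] : (exists k, P k) \/ (forall k, ~~ P k).
  case: (boolP [exists k : 'I_(size c), P k]) => [/existsP[k Pk]|/existsPn no].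
    by left; exists k.
  right=> k; have [kc|ck] := ltnP k (size c); first exact: (no (Ordinal kc)).
  by have := no (Ordinal (ltnW (ltnW sc))); rewrite /P rot0 rot_oversize.
  move: Pk; rewrite /P; case E: (rot k c) => [|x [|u [|y r]]] // d.
  exists C, x, u, y, r.
  by rewrite /winding -E unoriented_hole_rot size_rot cycle_sum_rot.
have alt k x u y r : rot k c = [:: x, u, y & r] ->
    (arrow C x u && arrow C y u) || (arrow C u x && arrow C u y).
  move=> E; have nd : ~~ directed_turn C x u y.
    by have := none k; rewrite /P E.
  have := unoriented_hole_cycle g; rewrite -(rot_cycle k) E /= => /and3P[+ + _].
  move: nd; rewrite /directed_turn /edge !negb_or.
  by do 4!case: (arrow C _ _).
(* One of two consecutive vertices is a source. *)
have [k [x [v [y [r [E kc vx vy]]]]]] : exists k x v y r, [/\ rot k c = [:: x, v, y & r],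
    (k <= size c)%N, arrow C v x & arrow C v y].
  move: (alt 0%N); rewrite rot0; case Ec: c sc => [|x [|u [|y r]]] // sc /(_ _ _ _ _ erefl).
  case/orP=> /andP[a1 a2]; last by exists 0%N, x, u, y, r; rewrite rot0.
  have [z [r' E']] : exists z r', rcons r x = z :: r'.
    by case: (r) => [|z t]; [exists x, [::] | exists z, (rcons t x)].
  have R : rot 1 [:: x, u, y & r] = [:: u, y, z & r'] by rewrite rot1_cons /= E'.
  exists 1%N, u, y, z, r'; split=> //.
  move: (alt 1%N); rewrite Ec R => /(_ _ _ _ _ erefl); rewrite a2 (arrow_asym a2) /=; exact.
have g1 : unoriented_hole C [:: x, v, y & r] by rewrite -E unoriented_hole_rot.
have [C' [tp' g' cy a ar]] := mutate_at_source tp g1 vx vy.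
have L := lastI y r; set z := last y r in L; set r3 := belast y r in L.
have R : rot (size [:: x, v & r3]) (rot k c) = [:: z, x, v & r3].
  rewrite E L -cats1.
  by rewrite (_ : [:: x, v & r3 ++ [:: z]] = [:: x, v & r3] ++ [:: z]) // rot_size_cat.
have zyr : z \in y :: r by rewrite mem_last.
have zx : arrow C z x.
  have [m Em] : exists m, rot (size [:: x, v & r3]) (rot k c) = rot m c.
    eexists; apply: rot_add_mod => //.
    by rewrite -(size_rot k c) E L -cats1 /= size_cat !ltnS leq_addr.
  (* [z -> x], since [x] receives an arrow from [v] and so is a sink *)
  have := alt m z x v r3; rewrite -Em R => /(_ erefl).
  by rewrite vx (arrow_asym vx) andbF orbF andbT.
exists C', z, x, v, r3.
have R' : [:: z, x, v & r3] = rot (size [:: x, v & r3]) [:: x, v, y & r].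
  by rewrite -R E.
move: cy; rewrite R' /winding => cy.
rewrite unoriented_hole_rot size_rot cycle_sum_rot -E size_rot E cy -E cycle_sum_rot.
split=> //; first by rewrite E.
by rewrite /directed_turn (ar _ zyr zx) a.
Qed.

(** In a cycle of length two the steps run along the same edge in opposite
directions and cancel; longer cycles are shortened. *)
Lemma winding_eq0 C c :
  totally_proper C -> unoriented_hole C c -> winding C c = 0.
Proof.
move: {2}(size c) (leqnn (size c)) => n.
elim: n C c => [|n IH] C c sc tp g; first by case: c sc g.
case: (ltnP 2 (size c)) => sc2.
  have [C' [x [u [y [r [tp' g' sz <- d]]]]]] := exists_directed_turn tp g sc2.
  have [C2 [tp2 g2 <-]] := shorten_at_turn tp' g' d.
  by apply: IH => //; rewrite -ltnS (leq_trans _ sc) // -sz.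
rewrite /winding; case: c sc2 {sc g} => [|x [|y []]] //= _.
  by rewrite /winding_step arrowxx addr0.
by rewrite (winding_stepN _ _ x y); ring.
Qed.

(** * Acyclic quivers and the bound *)

Lemma acyclic_unoriented_hole C c :
  acyclic C -> chordless (edge C) c -> c != [::] -> unoriented_hole C c.
Proof.
move=> ac ch c0; rewrite /unoriented_hole ch /=; apply/andP; split.
  by apply: contra c0 => /ac ->.
apply: contra c0; rewrite -rev_cycle => /ac /(congr1 rev); rewrite revK => -> //.
Qed.

(** Vertices are sorted by the number of their ancestors. *)
Lemma acyclic_topological Q : acyclic Q ->
  exists s, enumeration s /\ forall x y, arrow Q x y -> before s x y.
Proof.
move=> ac; pose rk x := #|[set z | connect (arrow Q) z x]|.
have rkP x y : arrow Q x y -> (rk x < rk y)%N.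
  move=> xy; apply/proper_card/properP; split.
    by apply/subsetP => z; rewrite !inE => h; apply: connect_trans h (connect1 xy).
  exists y; rewrite !inE ?connect0 //; apply/negP => /connectP[p yp e].
  have := ac (y :: p); rewrite /= rcons_path yp -e xy => /(_ isT) //.
pose le x y := (rk x <= rk y)%N.
exists (sort le (enum V)); split.
  by split=> [|x]; rewrite ?sort_uniq ?enum_uniq // mem_sort mem_enum.
move=> x y /rkP h; rewrite /before ltnNge; apply: contraTN h => h.
rewrite -leqNgt; apply: (sorted_leq_index (leT := le)) h; rewrite ?mem_sort ?mem_enum //.
- by move=> a b d; apply: leq_trans.
- by move=> a; apply: leqnn.
- by apply: sort_sorted => a b; apply: leq_total.
Qed.

(** The winding numbers vanish, so they come from a potential [g], and - g is the
coboundary between the given ordering and a topological one. *)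
Lemma acyclic_markov C : totally_proper C -> acyclic C -> (0 < #|V|)%N ->
  (num_adjacencies C)%:Z <= markov C.
Proof.
move=> tp ac n0; set o := ordering C.
have [g gP] : exists g : V -> int,
    forall x y, edge C x y -> winding_step C o x y = g y - g x.
  apply: potential; first exact: edge_sym.
    by move=> x y; apply: winding_stepN.
  apply: cycle_sum_eq0; [exact: edge_irreflexive | exact: edge_sym | by move=> x y; apply: winding_stepN|].
  move=> c ch; have [->//|c0] := eqVneq c [::].
  by apply: winding_eq0 => //; apply: acyclic_unoriented_hole.
have [s [es fw]] := acyclic_topological ac.
have eo := ordering_enumeration C.
have co : cohomologous C o s.
  exists (fun x => - g x) => x y xy; rewrite (fw _ _ xy).
  have := gP x y; rewrite /edge xy => /(_ isT).
  rewrite /winding_step xy (beforeN eo) ?(arrow_neq xy) // -/o.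
  by case: (before o x y) => /=; lia.
rewrite /markov alexanderE -(vertex_alexander_cohomologous eo es co).
exact: forward_ordering_bound.
Qed.

(** The ordering produced by the mutation ends with [v], while the computation of
the polynomial uses the rotation that starts with [v]. *)
Lemma mutate_markov C v : totally_proper C ->
  exists C', [/\ totally_proper C', COQ_quiver C' = mutate C v & markov C' = markov C].
Proof.
move=> tp; have [C' [s1 [s2 [[tp' q' es] c1 c2 i2 o1]]]] := totally_proper_mutate v tp.
exists C'; split=> //; rewrite /markov !alexanderE.
have eo := ordering_enumeration C; have eo' := ordering_enumeration C'.
rewrite -(vertex_alexander_cohomologous eo es c1) -(vertex_alexander_mutate es i2 o1) -q'.
have e' := enumeration_mutated es.
have ev : enumeration (v :: s2 ++ s1).
  by apply: (@enumeration_catC _ (s2 ++ s1) [:: v]); rewrite -catA.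
rewrite -(vertex_alexander_cohomologous eo' e' c2) (vertex_alexander_cohomologous ev e') //.
by have := @cohomologous_catC _ C' [:: v] (s2 ++ s1) ev; rewrite -catA.
Qed.

End WindingVanishes.

Theorem corollary6p6 (V : finType) (C : COQ V)
    (hproper : totally_proper C) (hacyclic : mutation_acyclic C) :
  0 <= markov C /\ (connected C -> #|V|%:Z - 1 <= markov C).
Proof.
(* On no vertices the determinant is that of the empty matrix, which is 1. *)
have [n0|n0] := posnP #|V|.
  have E : markov C = 1.
    rewrite /markov /alexander.
    set M := (X in \det X); have -> : \det M = 1.
      clearbody M; move: M; rewrite n0 => M; exact: det_mx00.
    by rewrite n0 coef1.
  by rewrite E n0.
case: hacyclic => Q' [vs EQ] ac.
have [C' [tp' q' m' cn]] : exists C', [/\ totally_proper C', COQ_quiver C' = Q',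
    markov C' = markov C & connected C -> connected C'].
  rewrite EQ; elim: vs C hproper {EQ} => [|v vs IH] C tp /=; first by exists C.
  have [C1 [tp1 q1 m1]] := mutate_markov v tp.
  have [C2 [tp2 q2 m2 cn2]] := IH _ tp1; rewrite q1 in q2 cn2.
  exists C2; split=> //; first by rewrite m2.
  by move=> /(connected_mutate v) /cn2.
rewrite -q' in ac; have H := acyclic_markov tp' ac n0; rewrite -m'; split.
  by apply: le_trans H.
move=> /cn cC; apply: le_trans H.
by have := connected_num_adjacencies n0 cC; lia.
Qed.
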